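(* There is a universal constant $c \ge 1$ such that, for all sufficiently large depths $d$ and all composite $m$ with $r$ prime factors, every symmetric Boolean function on $n$ bits can be computed by a circuit consisting of $\text{MOD}_m$ gates, of depth $d$ and size $\exp(O(n^{c/((d-c)(r-1))}))$.
   Context: A Boolean function $f:\{0,1\}^n\to\{0,1\}$ is symmetric if $f(\mathbf{x})$ depends only on the number of ones in $\mathbf{x}$. A $\text{MOD}_m$ gate has unbounded fan-in and outputs $1$ iff the sum of its Boolean inputs (counted with multiplicity of wires) is divisible by $m$. Circuits take the input variables (and constants) as inputs; size is the number of gates. The $O(\cdot)$ is as $n\to\infty$ with $d,m$ fixed. *)

(* Defs.v *)
From mathcomp Require Import all_boot.

Set Implicit Arguments.
Unset Strict Implicit.
Unset Printing Implicit Defensive.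

Definition composite (m : nat) : bool := (1 < m) && ~~ prime m.

Definition symmetric_fun (n : nat) (f : n.-tuple bool -> bool) : Prop :=
  forall x y : n.-tuple bool,
    count_mem true x = count_mem true y -> f x = f y.

(* [Gate i] refers to the i-th gate of the circuit, counted from 0. *)
Inductive wire (n : nat) : Type :=
  | Input of 'I_n
  | Const of bool
  | Gate of nat.
Arguments Const {n}.
Arguments Gate {n}.

Definition wire_before (n k : nat) (w : wire n) : bool :=
  if w is Gate i then i < k else true.

(* A circuit is a DAG whose gates are listed in topological order; gates may
   be shared.  A gate is the list of its incoming wires, where repetitions
   count as parallel wires.  Every gate is a MOD_m gate, so m itself only
   enters when the circuit is evaluated. *)
Record circuit (n : nat) : Type := Circuit {
  gates : seq (seq (wire n));
  output : nat;
  gates_acyclic : forall k, k < size gates ->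
                    all (wire_before k) (nth [::] gates k);
  output_gate : output < size gates
}.

Definition mod_gate (m : nat) (s : seq bool) : bool :=
  m %| \sum_(b <- s) b.

Definition wire_value (n : nat) (x : n.-tuple bool) (vals : seq bool)
    (w : wire n) : bool :=
  match w with
  | Input i => tnth x i
  | Const b => b
  | Gate i => nth false vals i
  end.

Definition gate_values (m n : nat) (x : n.-tuple bool)
    (gs : seq (seq (wire n))) : seq bool :=
  foldl (fun vals g => rcons vals (mod_gate m (map (wire_value x vals) g)))
        [::] gs.

Definition circuit_eval (m n : nat) (C : circuit n) (x : n.-tuple bool) : bool :=
  nth false (gate_values m x (gates C)) (output C).

Definition wire_depth (n : nat) (ds : seq nat) (w : wire n) : nat :=
  if w is Gate i then nth 0 ds i else 0.

Definition gate_depths (n : nat) (gs : seq (seq (wire n))) : seq nat :=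
  foldl (fun ds g => rcons ds (\max_(w <- g) wire_depth ds w).+1) [::] gs.

Definition circuit_depth (n : nat) (C : circuit n) : nat :=
  \max_(k <- gate_depths (gates C)) k.

Definition circuit_size (n : nat) (C : circuit n) : nat := size (gates C).

(* Main.v *)
Require Import Defs.
From mathcomp Require Import all_boot all_order all_algebra.
From mathcomp Require Import zify ring lra.

(** Let [p_1, ..., p_r] be the primes of [m].  Modulo [p ^ e], a sum of [N] bits
    is determined mod [p] by the binomials of index below [p ^ e], so any
    function of that residue is a MOD_p gate over ANDs of fewer than [p ^ e]
    bits, and an AND of [k] bits costs [exp (O(k))] using two primes of [m].
    Choosing [p_i ^ e_i] slightly above [N ^ (1 / r)] and applying the Chinese
    remainder theorem, every symmetric function of [N] bits has constant depth
    and size [exp (N ^ (1 / r + o(1)))].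

    To trade depth for size, write [n <= b ^ t] with [t] proportional to [d] and
    choose [t] pairwise coprime moduli [M] of order [b], which together determine
    the weight of the input.  The weight modulo [M] is computed along a [b]-ary
    tree of [t] levels; each node is a symmetric function of [b * M = O(b ^ 2)]
    bits, whence an exponent of order [1 / (t * r)].  Since the depth is constant,
    gates need not be shared: a bound [F] on the fan-ins gives size [F ^ O(1)]. *)

Set Implicit Arguments.
Unset Strict Implicit.
Unset Printing Implicit Defensive.

(** * Formulas of bounded fan-in and their realization as circuits *)

(** Tree-like circuits: [F] bounds the fan-ins and [D] the depth. Functions form no [eqType], so the
    subcircuits are indexed through [nth], whose default, the constant [false], is itself
    computable. *)
Inductive computable (m F n : nat) : nat -> (n.-tuple bool -> bool) -> Prop :=
  | computable_input D h i : h =1 (fun x => tnth x i) -> computable m F D h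
  | computable_const D h b : h =1 (fun=> b) -> computable m F D h
  | computable_gate D h (gs : seq (n.-tuple bool -> bool)) :
      size gs <= F -> (forall i, computable m F D (nth (fun=> false) gs i)) ->
      (forall x, h x = (m %| \sum_(g <- gs) g x)) -> computable m F D.+1 h.

Definition acyclic n (gs : seq (seq (wire n))) : Prop :=
  forall k, k < size gs -> all (wire_before k) (nth [::] gs k).

Lemma gate_values_rcons m n (x : n.-tuple bool) gs g :
  gate_values m x (rcons gs g) =
  rcons (gate_values m x gs)
        (mod_gate m (map (wire_value x (gate_values m x gs)) g)).
Proof. by rewrite /gate_values foldl_rcons. Qed.

Lemma gate_depths_rcons n (gs : seq (seq (wire n))) g :
  gate_depths (rcons gs g) =
  rcons (gate_depths gs) (\max_(w <- g) wire_depth (gate_depths gs) w).+1.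
Proof. by rewrite /gate_depths foldl_rcons. Qed.

Lemma size_gate_values m n (x : n.-tuple bool) gs :
  size (gate_values m x gs) = size gs.
Proof.
by elim/last_ind: gs => // gs g IH; rewrite gate_values_rcons !size_rcons IH.
Qed.

Lemma size_gate_depths n (gs : seq (seq (wire n))) :
  size (gate_depths gs) = size gs.
Proof.
by elim/last_ind: gs => // gs g IH; rewrite gate_depths_rcons !size_rcons IH.
Qed.

Lemma wire_value_cat m n (x : n.-tuple bool) gs1 gs2 w :
  wire_before (size gs1) w ->
  wire_value x (gate_values m x (gs1 ++ gs2)) w =
  wire_value x (gate_values m x gs1) w.
Proof.
case: w => //= i lti; elim/last_ind: gs2 => [|gs2 g <-]; first by rewrite cats0.
rewrite -rcons_cat gate_values_rcons nth_rcons size_gate_values size_cat.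
by rewrite (leq_trans lti (leq_addr _ _)).
Qed.

Lemma wire_depth_cat n (gs1 gs2 : seq (seq (wire n))) (w : wire n) :
  wire_before (size gs1) w ->
  wire_depth (gate_depths (gs1 ++ gs2)) w = wire_depth (gate_depths gs1) w.
Proof.
case: w => //= i lti; elim/last_ind: gs2 => [|gs2 g <-]; first by rewrite cats0.
rewrite -rcons_cat gate_depths_rcons nth_rcons size_gate_depths size_cat.
by rewrite (leq_trans lti (leq_addr _ _)).
Qed.

Lemma acyclic_rcons n (gs : seq (seq (wire n))) ws :
  acyclic gs -> all (wire_before (size gs)) ws -> acyclic (rcons gs ws).
Proof.
move=> acy wsP k; rewrite size_rcons ltnS nth_rcons leq_eqVlt.
case/orP=> [/eqP->|ltk]; first by rewrite ltnn eqxx.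
by rewrite ltk; apply: acy.
Qed.

Lemma wire_beforeW n k l (w : wire n) :
  k <= l -> wire_before k w -> wire_before l w.
Proof. by case: w => //= i lekl /leq_trans; apply. Qed.

(* Appends to any gate list at most [S] gates, of depth at most [D], one wire
   of which carries [h]; [E] bounds the depths of the gates already present. *)
Definition appendable m n D S (h : n.-tuple bool -> bool) : Prop :=
  forall E gs0, D <= E -> acyclic gs0 -> all (leq^~ E) (gate_depths gs0) ->
  exists gs1 w, let gs := gs0 ++ gs1 in
  [/\ acyclic gs /\ all (leq^~ E) (gate_depths gs), size gs1 <= S,
      wire_before (size gs) w,
      forall x, wire_value x (gate_values m x gs) w = h x
    & wire_depth (gate_depths gs) w <= D].

Lemma appendable_seq m n D S (hs : seq (n.-tuple bool -> bool)) :
  (forall i, appendable m D S (nth (fun=> false) hs i)) ->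
  forall E gs0, D <= E -> acyclic gs0 -> all (leq^~ E) (gate_depths gs0) ->
  exists gs1 ws, let gs := gs0 ++ gs1 in
  [/\ acyclic gs /\ all (leq^~ E) (gate_depths gs), size gs1 <= size hs * S,
      all (wire_before (size gs)) ws,
      forall x, map (wire_value x (gate_values m x gs)) ws =
                map (fun h => h x) hs
    & all (fun w => wire_depth (gate_depths gs) w <= D) ws].
Proof.
elim: hs => [|h hs IH] hP E gs0 leDE acy0 dep0.
  by exists [::], [::]; rewrite /= cats0.
have [gs1 [w [[acy1 dep1] sz1 bef1 val1 wd1]]] := hP 0 E gs0 leDE acy0 dep0.
have [gs2 [ws [acy2 sz2 bef2 val2 wd2]]] :=
  IH (fun i => hP i.+1) E _ leDE acy1 dep1.
exists (gs1 ++ gs2), (w :: ws); rewrite /= catA; split=> //.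
- by rewrite size_cat mulSn leq_add.
- by rewrite bef2 andbT (wire_beforeW _ bef1) // (size_cat (_ ++ _)) leq_addr.
- by move=> x; rewrite wire_value_cat // val1 val2.
- by rewrite wire_depth_cat // wd1 wd2.
Qed.

Lemma appendable_leq m n D S S' (h : n.-tuple bool -> bool) :
  S <= S' -> appendable m D S h -> appendable m D S' h.
Proof.
move=> leS hP E gs0 leDE acy0 dep0.
have [gs1 [w [? sz ? ? ?]]] := hP E gs0 leDE acy0 dep0.
by exists gs1, w; split=> //; apply: leq_trans leS.
Qed.

Lemma appendable_gate m n D S (h : n.-tuple bool -> bool) hs :
  (forall i, appendable m D S (nth (fun=> false) hs i)) ->
  (forall x, h x = (m %| \sum_(g <- hs) g x)) ->
  appendable m D.+1 (size hs * S).+1 h.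
Proof.
move=> hsP hE E gs0 leDE acy0 dep0.
have [gs1 [ws [[acy1 dep1] sz1 bef1 val1 wd1]]] :=
  appendable_seq hsP (ltnW leDE) acy0 dep0.
have maxD : \max_(w <- ws) wire_depth (gate_depths (gs0 ++ gs1)) w <= D.
  elim: ws wd1 {bef1 val1} => [|w ws IH] /=; first by rewrite big_nil.
  by case/andP=> le1 /IH le2; rewrite big_cons geq_max le1.
exists (rcons gs1 ws), (Gate (size (gs0 ++ gs1))).
rewrite /= -rcons_cat gate_depths_rcons; split.
- split; first exact: acyclic_rcons.
  by rewrite all_rcons dep1 andbT; apply: leq_trans leDE.
- by rewrite size_rcons ltnS.
- by rewrite size_rcons.
- move=> x; rewrite gate_values_rcons nth_rcons size_gate_values ltnn eqxx.
  by rewrite hE /mod_gate val1 big_map.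
- by rewrite nth_rcons size_gate_depths ltnn eqxx.
Qed.

Lemma computable_appendable m F n D (h : n.-tuple bool -> bool) :
  computable m F D h -> appendable m D (F.+1 ^ D) h.
Proof.
elim=> {D h} [D h i hE|D h b hE|D h gs szgs _ IH hE].
- move=> E gs0 _ acy0 dep0; exists [::], (Input i); rewrite cats0.
  by split=> // x; rewrite hE.
- move=> E gs0 _ acy0 dep0; exists [::], (Const b); rewrite cats0.
  by split=> // x; rewrite hE.
apply: appendable_leq (appendable_gate IH hE).
rewrite expnS mulSn -addn1 addnC leq_add ?expn_gt0 //.
by rewrite leq_mul2r szgs orbT.
Qed.

(** The output must be a gate, while the wire carrying the function may be an input or a constant. A
    final one-wire gate repairs this; it negates since [1 < m], hence the hypothesis on [~~ h x]. *)
Lemma computable_circuit m F n D (h : n.-tuple bool -> bool) :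
  1 < m -> computable m F D (fun x => ~~ h x) ->
  exists C : circuit n, [/\ circuit_eval m C =1 h, circuit_depth C <= D.+1
                          & circuit_size C <= (F.+1 ^ D).+1].
Proof.
move=> m1 /computable_appendable hP.
have [] := hP D.+1 [::]; rewrite ?leqnSn // => gs [w []]; rewrite cat0s.
move=> [acy dep] sz bef val wd.
have acy' : acyclic (rcons gs [:: w]) by apply: acyclic_rcons; rewrite //= bef.
have out : size gs < size (rcons gs [:: w]) by rewrite size_rcons.
exists (Circuit acy' out); split.
- move=> x; rewrite /circuit_eval /= gate_values_rcons nth_rcons.
  rewrite size_gate_values ltnn eqxx /mod_gate /= val big_seq1.
  by case: (h x); rewrite /= ?dvdn0 // gtnNdvd.
- rewrite /circuit_depth /= gate_depths_rcons big_seq1.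
  have: all (leq^~ D.+1) (rcons (gate_depths gs)
            (wire_depth (gate_depths gs) w).+1) by rewrite all_rcons ltnS wd.
  elim: (rcons _ _) => [|a s IH] /=; first by rewrite big_nil.
  by case/andP=> lea /IH les; rewrite big_cons geq_max lea.
- by rewrite /circuit_size /= size_rcons.
Qed.

(** * Simulation of MOD_p gates and negation *)

Lemma eq_computable m F n D (h h' : n.-tuple bool -> bool) :
  h =1 h' -> computable m F D h -> computable m F D h'.
Proof.
move=> hh' hP; case: hP hh' => {D h} [D h i hE|D h b hE|D h gs szgs gsP hE] hh'.
- by apply: (@computable_input _ _ _ _ _ i) => x; rewrite -hh'.
- by apply: (@computable_const _ _ _ _ _ b) => x; rewrite -hh'.
- by apply: computable_gate szgs gsP _ => x; rewrite -hh'.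
Qed.

Lemma computable_flatten m F n D (I : eqType) (s : seq I)
    (gs : I -> seq (n.-tuple bool -> bool)) :
  (forall i, i \in s ->
     forall j, computable m F D (nth (fun=> false) (gs i) j)) ->
  forall j, computable m F D (nth (fun=> false) (flatten (map gs s)) j).
Proof.
elim: s => [|i s IH] gsP j /=.
  by rewrite nth_nil; apply: (@computable_const _ _ _ _ _ false).
rewrite nth_cat; case: ifP => _; first by apply: gsP; rewrite mem_head.
by apply: IH => k ks; apply: gsP; rewrite inE ks orbT.
Qed.

Lemma computable_nseq m F n D k (h : n.-tuple bool -> bool) j :
  (0 < k -> computable m F D h) ->
  computable m F D (nth (fun=> false) (nseq k h) j).
Proof.
move=> hP; rewrite nth_nseq; case: ifP => [ltjk|_].
  by apply: hP; apply: leq_ltn_trans ltjk.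
exact: (@computable_const _ _ _ _ _ false).
Qed.

(* A MOD_m gate with every wire repeated [m / p] times acts as a MOD_p gate. *)
Lemma computable_mod m p F n D (I : finType) (w : I -> nat) c
    (ys : I -> n.-tuple bool -> bool) h :
  0 < m -> p %| m -> (m %/ p) * (\sum_i w i + c) <= F ->
  (forall i, 0 < w i -> computable m F D (ys i)) ->
  (forall x, h x = (p %| \sum_i w i * ys i x + c)) ->
  computable m F D.+1 h.
Proof.
move=> m0 pm leF ysP hE.
have k0 : 0 < m %/ p by rewrite divn_gt0 ?(dvdn_gt0 m0 pm) // dvdn_leq.
pose gs := flatten [seq nseq (m %/ p * w i) (ys i) | i <- enum I]
  ++ nseq (m %/ p * c) (fun=> true).
apply: (@computable_gate _ _ _ _ _ gs).
- apply: leq_trans leF; rewrite size_cat size_flatten sumnE /shape big_map.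
  rewrite big_map big_enum size_nseq mulnDr big_distrr /= leq_add2r.
  by apply: leq_sum => i _; rewrite size_nseq.
- move=> j; rewrite nth_cat; case: ifP => _.
    apply: computable_flatten => i _ {}j.
    by apply: computable_nseq; rewrite muln_gt0 => /andP[_]; apply: ysP.
  by apply: computable_nseq => _; apply: (@computable_const _ _ _ _ _ true).
- move=> x; rewrite hE -[RHS](@dvdn_pmul2l 1) // !mul1n.
  rewrite -(dvdn_pmul2l k0) divnK //; congr (_ %| _).
  rewrite big_cat big_flatten big_map big_enum big_nseq iter_addn_0 mul1n.
  rewrite mulnDr big_distrr; congr (_ + _); apply: eq_bigr => i _.
  by rewrite big_nseq iter_addn_0 /= mulnA mulnC.
Qed.

Lemma computable_not m F n D (h : n.-tuple bool -> bool) :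
  1 < m -> 0 < F -> computable m F D h -> computable m F D.+1 (fun x => ~~ h x).
Proof.
move=> m1 F0 hP; apply: (@computable_mod _ m _ _ _ unit (fun=> 1) 0 (fun=> h)).
- exact: ltnW.
- exact: dvdnn.
- by rewrite divnn (ltnW m1) big_const card_unit.
- by [].
- move=> x; rewrite big_const card_unit /= mul1n !addn0.
  by case: (h x); rewrite /= ?dvdn0 // gtnNdvd.
Qed.

(** * NOR from two distinct primes *)

Import GRing.Theory.

(** If [y j] holds, translating the coordinate [a j] by [s] maps the zero fiber of the linear form
    [L] onto the fiber over [s], so all [q] fibers have the same size. The factor [q] on the left
    avoids a division. *)
Lemma card_hyperplane (q : nat) (I : finType) (y : I -> bool) : prime q ->
  q * \sum_(a : {ffun I -> 'F_q}) (q %| \sum_i a i * y i) =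
  q ^ #|I| * (if [forall i, ~~ y i] then q else 1).
Proof.
move=> qpr; pose L (a : {ffun I -> 'F_q}) : 'F_q := (\sum_i a i *+ y i)%R.
have dvdL (a : {ffun I -> 'F_q}) : (q %| \sum_i a i * y i) = (L a == 0%R).
  rewrite (dvdn_pcharf (pchar_Fp qpr)) natr_sum; congr (_ == _).
  by apply: eq_bigr => i _; rewrite natrM mulr_natr natr_Zp.
under eq_bigr do rewrite dvdL.
have cardT : \sum_(a : {ffun I -> 'F_q}) 1 = q ^ #|I|.
  by rewrite sum1_card card_ffun card_Fp.
case: forallP => [y0|/forallP].
  rewrite mulnC -cardT; congr (_ * _); apply: eq_bigr => a _.
  by rewrite /L big1 ?eqxx // => i _; rewrite (negbTE (y0 i)).
rewrite negb_forall => /existsP[j /negPn yj].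
pose sh s : {ffun I -> 'F_q} := [ffun i => if i == j then s else 0%R].
have Lsh a s : L (a + sh s)%R = (L a + s)%R.
  rewrite /L; under eq_bigr do rewrite ffunE mulrnDl.
  rewrite big_split /=; congr (_ + _)%R; rewrite (bigD1 j) //= big1 => [|i ij].
    by rewrite ffunE eqxx yj addr0.
  by rewrite ffunE (negbTE ij) mul0rn.
rewrite muln1 -cardT; transitivity
  (\sum_(s : 'F_q) \sum_(a : {ffun I -> 'F_q}) (L a == s)).
  transitivity (\sum_(s : 'F_q) \sum_(a : {ffun I -> 'F_q}) (L a == 0%R)).
    by rewrite sum_nat_const card_Fp.
  apply: eq_bigr => s _; rewrite [RHS](reindex_inj (addIr (sh s))) /=.
  by apply: eq_bigr => a _; rewrite Lsh -{2}[s]add0r (inj_eq (addIr s)).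
rewrite exchange_big /=; apply: eq_bigr => a _.
rewrite (bigD1 (L a)) //= eqxx big1 ?addn0 // => s sL.
by rewrite eq_sym (negbTE sL).
Qed.

(* The hyperplane count is [q ^ #|I|] if all [y i] vanish and [q ^ #|I|.-1]
   otherwise; as [0 < q - 1 < p], the prime [p] distinguishes the two. *)
Lemma computable_nor m p q F n D (I : finType) (ys : I -> n.-tuple bool -> bool) :
  0 < m -> prime p -> prime q -> q < p -> p %| m -> q %| m ->
  m ^ #|I|.+1 <= F -> (forall i, computable m F D (ys i)) ->
  computable m F D.+2 (fun x => [forall i, ~~ ys i x]).
Proof.
move=> m0 ppr qpr ltqp pm qm leF ysP.
have q0 := prime_gt0 qpr; have leqm : q <= m by apply: dvdn_leq.
have m1 : 1 < m := leq_trans (prime_gt1 qpr) leqm.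
pose Q := q ^ #|I|.
(* With the constant [(p - 1) * Q] added, [q] times the sum is [p * q * Q] when all inputs vanish
   and [Q * (1 + q * (p - 1))] otherwise. *)
apply: (@computable_mod _ p _ _ _ {ffun I -> 'F_q} (fun=> 1) ((p - 1) * Q)
  (fun a x => q %| \sum_i a i * ys i x)) => //.
- rewrite sum1_card card_ffun card_Fp // -/Q -{1}[Q]mul1n -mulnDl.
  rewrite subnKC ?prime_gt0 // mulnA divnK //; apply: leq_trans leF.
  rewrite expnS leq_mul2l /Q; case: #|I| => [|k]; first by rewrite orbT.
  by rewrite leq_exp2r // leqm orbT.
- move=> a _.
  apply: (@computable_mod _ q _ _ _ _ (fun i => a i : nat) 0 ys) => //.
  + rewrite addn0; apply: (@leq_trans (m %/ q * \sum_(i : I) q)).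
      rewrite leq_mul2l; apply/orP; right; apply: leq_sum => i _; apply: ltnW.
      by have := ltn_ord (a i); rewrite [X in _ < X -> _]Fp_cast.
    rewrite sum_nat_const mulnCA divnK // mulnC; apply: leq_trans leF.
    by rewrite expnS leq_mul2l ltnW ?orbT // ltn_expl.
  + by move=> x; rewrite addn0.
- move=> x; under eq_bigr do rewrite mul1n.
  rewrite -(@Gauss_dvdr _ q); last first.
    by rewrite prime_coprime // gtnNdvd // prime_gt0.
  rewrite mulnDr card_hyperplane // -/Q; case: ifP => _.
    rewrite [Q * q]mulnC [q * (_ * _)]mulnCA -mulSn subn1 prednK ?prime_gt0 //.
    by rewrite dvdn_mulr.
  apply/esym/negbTE; rewrite muln1 mulnA -{1}[Q]mul1n -mulnDl.
  rewrite Gauss_dvdl; last first.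
    by rewrite coprimeXr // prime_coprime // gtnNdvd.
  (* Adding [q - 1] to [1 + q * (p - 1)] gives [q * p], so [p] would divide [q - 1]. *)
  apply/negP => pdvd; have := dvdn_addr (q - 1) pdvd.
  rewrite addnAC subnKC // -{1}[q]muln1 -mulnDr subnKC ?prime_gt0 //.
  rewrite dvdn_mull // gtnNdvd ?subn_gt0 ?prime_gt1 //.
  by rewrite (leq_ltn_trans _ ltqp) // leq_subr.
Qed.

(** * Functions of a residue modulo a prime power *)

(** Since [i * 'C(p ^ e, i) = p ^ e * 'C(p ^ e - 1, i - 1)], a binomial prime to [p] would force
    [p ^ e] to divide [i]. *)
Lemma dvdn_bin_prime_power p e i :
  prime p -> 0 < i < p ^ e -> p %| 'C(p ^ e, i).
Proof.
case: i => // i ppr ltie; apply: contraLR ltie; rewrite -prime_coprime // => cop.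
rewrite -leqNgt dvdn_leq // -(@Gauss_dvdl _ _ 'C(p ^ e, i.+1)) ?coprimeXl //.
by rewrite -mul_bin_diag dvdn_mulr.
Qed.

(** By Vandermonde, adding [p ^ e] to [w] only adds multiples of ['C(p ^ e, i)] with
    [0 < i <= j < p ^ e], all divisible by [p]. *)
Lemma bin_modn_prime_power p e w j : prime p -> j < p ^ e ->
  'C(w, j) = 'C(w %% p ^ e, j) %[mod p].
Proof.
move=> ppr ltj; rewrite {1}(divn_eq w (p ^ e)).
elim: (w %/ _) => [|k <-]; first by rewrite mul0n.
rewrite mulSn -addnA -binomial.Vandermonde big_ord_recl bin0 mul1n subn0.
rewrite -modnDmr; set s := \sum_(_ < _) _.
suff /eqP-> : p %| s by rewrite addn0.
apply: dvdn_sum => i _; rewrite dvdn_mulr // dvdn_bin_prime_power //=.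
by rewrite (leq_ltn_trans _ ltj) // ltn_ord.
Qed.

(** The matrix of binomials is triangular with unit diagonal, so the coefficients are found one
    after another without dividing modulo [p]. *)
Lemma binomial_basis p (h : nat -> nat) d : 0 < p ->
  exists2 c : nat -> nat, forall j, c j < p &
    forall w, w < d -> \sum_(j < d) c j * 'C(w, j) = h w %[mod p].
Proof.
move=> p0; elim: d => [|d [c ltc cE]]; first by exists (fun=> 0).
pose s := \sum_(j < d) c j * 'C(d, j).
(* Modulo [p], the factor [p - 1] stands for [-1]. *)
exists (fun j => if j == d then (h d + (p - 1) * s) %% p else c j) => [j|w].
  by case: ifP; rewrite ?ltn_mod.
rewrite ltnS leq_eqVlt big_ord_recr /= eqxx.
rewrite (eq_bigr (fun j : 'I_d => c j * 'C(w, j))) => [|j _]; last first.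
  by rewrite ltn_eqF.
case/orP=> [/eqP->|ltwd]; last by rewrite (bin_small ltwd) muln0 addn0 cE.
rewrite binn muln1 modnDmr -/s addnCA -mulSn subn1 prednK //.
by rewrite -modnDmr modnMr addn0.
Qed.

Lemma leq_bin_expn n j : 'C(n, j) <= n ^ j.
Proof.
elim: j => [|j IH]; first by rewrite bin0.
apply: (@leq_trans (j.+1 * 'C(n, j.+1))); first exact: leq_pmull.
by rewrite mul_bin_left expnS leq_mul // leq_subr.
Qed.

(* The indicator [g] of residues mod [p ^ e] is, mod [p], an integer combination
   of the binomials ['C(W, j)] with [j < p ^ e], and ['C(W, j)] counts the
   [j]-sets all of whose inputs are on. *)
Lemma computable_prime_power m p1 p2 p e F n D N
    (ys : 'I_N -> n.-tuple bool -> bool) (g : nat -> bool) :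
  0 < m -> prime p1 -> prime p2 -> p2 < p1 -> p1 %| m -> p2 %| m ->
  prime p -> p %| m -> m ^ (p ^ e).+1 <= F ->
  m * (p ^ e * N.+1 ^ (p ^ e)).+1 <= F ->
  (forall i, computable m F D (ys i)) ->
  computable m F D.+4 (fun x => g ((\sum_i ys i x) %% p ^ e)).
Proof.
move=> m0 p1pr p2pr ltp21 p1m p2m ppr pm leF1 leF2 ysP.
have p0 := prime_gt0 ppr.
have m1 : 1 < m by apply: leq_trans (prime_gt1 ppr) (dvdn_leq m0 pm).
have [c ltc cE] := binomial_basis g (p ^ e) p0.
(* The weight is [c #|S|] if [#|S| < p ^ e] and 0 for larger sets. *)
pose w (S : {set 'I_N}) := \sum_(j < p ^ e) (#|S| == j) * c j.
(* An AND, written as a NOR of negations. *)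
pose mon (S : {set 'I_N}) x := [forall i : {i | i \in S}, ~~ ~~ ys (val i) x].
have sumw (b : {set 'I_N} -> bool) : \sum_S w S * b S =
    \sum_(j < p ^ e) c j * #|[set S | b S & #|S| == j]|.
  under eq_bigr do rewrite big_distrl /=.
  rewrite exchange_big /=; apply: eq_bigr => j _.
  rewrite -sum1dep_card [in RHS]big_mkcond big_distrr /=; apply: eq_bigr => S _.
  by case: (b S); case: (_ == _); rewrite /= ?muln0 ?mul0n ?mul1n.
(* The weighted sum is congruent to the bit given by [g], so adding [p - 1] makes it divisible by
   [p] exactly when that bit is 1. *)
apply: (@computable_mod _ p _ _ _ _ w (p - 1) mon) => //.
- have -> : \sum_S w S = \sum_(j < p ^ e) c j * 'C(N, j).
    transitivity (\sum_S w S * true).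
      by apply: eq_bigr => S _; rewrite muln1.
    rewrite (sumw predT); apply: eq_bigr => j _; congr (_ * _).
    by rewrite -[N in RHS]card_ord -card_draws; apply: eq_card => S; rewrite !inE.
  apply: leq_trans leF2; rewrite -{2}(divnK pm) -mulnA leq_mul2l.
  apply/orP; right; rewrite mulnS addnC leq_add ?leq_subr //.
  apply: (@leq_trans (\sum_(j < p ^ e) p * N.+1 ^ p ^ e)).
    apply: leq_sum => j _; apply: leq_mul; first exact: ltnW.
    apply: leq_trans (leq_bin_expn _ _) _.
    case: (posnP j) => [->|j0]; first by rewrite expn0 expn_gt0.
    apply: (@leq_trans (N.+1 ^ j)); first by rewrite leq_exp2r.
    by rewrite leq_pexp2l // ltnW.
  by rewrite sum_nat_const card_ord mulnCA.
- move=> S w0; case: (posnP (\sum_(j < p ^ e) (#|S| == j))) => [|].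
    move=> s0; move: w0; rewrite /w big1 // => j _.
    move/eqP: s0; rewrite sum_nat_eq0 => /forallP/(_ j) /=.
    by move=> /eqP->.
  rewrite lt0n sum_nat_eq0 negb_forall => /existsP[j].
  rewrite /= eqb0 negbK => /eqP Sj.
  have F0 : 0 < F by apply: leq_trans leF1; rewrite expn_gt0 m0.
  apply: (computable_nor m0 p1pr p2pr) => // [|i]; last exact: computable_not.
  apply: leq_trans leF1; rewrite leq_exp2l // ltnS card_sig.
  by rewrite (_ : #|_| = #|S|) ?Sj ?(ltnW (ltn_ord j)) //; apply: eq_card.
- move=> x; pose Y := [set i | ys i x].
  have monE S : mon S x = (S \subset Y).
    apply/forallP/subsetP => [H i iS|H [i iS] /=].
      by have := H (exist _ i iS); rewrite inE negbK.
    by rewrite negbK; have := H i iS; rewrite inE.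
  under [in RHS]eq_bigr do rewrite monE.
  rewrite sumw; under [in RHS]eq_bigr do rewrite cards_draws.
  have -> : \sum_i ys i x = #|Y|.
    rewrite -sum1dep_card [RHS]big_mkcond; apply: eq_bigr => i _.
    by case: (ys i x).
  have := cE (#|Y| %% p ^ e); rewrite ltn_mod expn_gt0 p0 => /(_ isT) gE.
  have lucas : \sum_(j < p ^ e) c j * 'C(#|Y|, j) =
            \sum_(j < p ^ e) c j * 'C(#|Y| %% p ^ e, j) %[mod p].
    rewrite -modn_summ -[RHS]modn_summ; congr (_ %% p); apply: eq_bigr => j _.
    by rewrite -modnMmr (@bin_modn_prime_power p e) // modnMmr.
  rewrite /dvdn -modnDml lucas gE modnDml.
  case: (g _) => /=; first by rewrite subnKC // modnn.
  by rewrite modn_small ?ltn_subrL ?p0 // subn_eq0 leqNgt prime_gt1.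
Qed.

(** * Chinese remaindering and symmetric functions in constant depth *)

Lemma dvdn_prod_prime_powers (ps : seq nat) (e : nat -> nat) z :
  all prime ps -> uniq ps -> {in ps, forall p, p ^ e p %| z} ->
  \prod_(p <- ps) p ^ e p %| z.
Proof.
elim: ps => [|p ps IH] /=; first by rewrite big_nil dvd1n.
case/andP=> ppr pspr /andP[pps ups] zP; rewrite big_cons Gauss_dvd.
  rewrite zP ?mem_head // IH // => q qps; apply: zP.
  by rewrite inE qps orbT.
elim: ps pspr pps {IH ups zP} => [|q ps IH] /=.
  by rewrite big_nil coprimen1.
case/andP=> qpr pspr; rewrite inE negb_or big_cons coprimeMr => /andP[pq pps].
by rewrite IH // andbT coprimeXl // coprimeXr // prime_coprime // dvdn_prime2.
Qed.

Lemma residues_inj (ps : seq nat) (e : nat -> nat) w w' :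
  all prime ps -> uniq ps ->
  w < \prod_(p <- ps) p ^ e p -> w' < \prod_(p <- ps) p ^ e p ->
  {in ps, forall p, w = w' %[mod p ^ e p]} -> w = w'.
Proof.
move=> pspr ups; wlog le_ww' : w w' / w' <= w => [W ltw ltw' ww'|].
  case/orP: (leq_total w' w) => le_ww'; first exact: W.
  by apply/esym/W => // p pps; apply/esym/ww'.
move=> ltw _ ww'; apply/eqP; rewrite eqn_leq le_ww' andbT -subn_eq0 -leqn0.
rewrite leqNgt; apply/negP => sub0.
suff /(dvdn_leq sub0) : \prod_(p <- ps) p ^ e p %| w - w'.
  by rewrite leqNgt (leq_ltn_trans (leq_subr _ _)).
apply: dvdn_prod_prime_powers => // p pps.
by rewrite -eqn_mod_dvd //; apply/eqP/ww'.
Qed.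

(** Exactly one candidate [w <= N] agrees with [W x] in all residues, and agreement is a NOR of
    disagreements. The last gate sums over the [w] where [g] fails, since a MOD_m gate negates a
    single bit. *)
Lemma computable_crt m p1 p2 (ps : seq nat) (e : nat -> nat) F n D N
    (W : n.-tuple bool -> nat) (g : nat -> bool) :
  0 < m -> prime p1 -> prime p2 -> p2 < p1 -> p1 %| m -> p2 %| m ->
  all prime ps -> uniq ps -> N < \prod_(p <- ps) p ^ e p ->
  m ^ (size ps).+1 <= F -> N < F -> (forall x, W x <= N) ->
  (forall p, p \in ps -> forall g' : nat -> bool,
     computable m F D (fun x => g' (W x %% p ^ e p))) ->
  computable m F D.+3 (fun x => g (W x)).
Proof.
move=> m0 p1pr p2pr ltp21 p1m p2m pspr ups ltN leF1 ltF WN resP.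
pose q (i : 'I_(size ps)) := nth 0 ps i ^ e (nth 0 ps i).
pose E w x := [forall i, ~~ (W x %% q i != w %% q i)].
apply: (@computable_mod _ m _ _ _ 'I_N.+1 (fun w => ~~ g w) 0 E) => //.
- rewrite divnn m0 mul1n addn0; apply: leq_trans ltF.
  apply: (@leq_trans (\sum_(w < N.+1) 1)).
    by apply: leq_sum => w _; case: (g w).
  by rewrite sum_nat_const card_ord muln1.
- move=> w _; apply: (computable_nor m0 p1pr p2pr) => // [|i].
    by rewrite card_ord.
  exact: (resP _ (mem_nth 0 (ltn_ord i)) (fun v => v != w %% q i)).
- move=> x.
  have EE w : w <= N -> E w x = (W x == w).
    move=> leN.
    apply/forallP/eqP => [H|-> i]; last by rewrite eqxx.
    apply: (residues_inj pspr ups) => [||p pps].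
    + exact: leq_ltn_trans (WN x) ltN.
    + exact: leq_ltn_trans leN ltN.
    + have ltp : index p ps < size ps by rewrite index_mem.
      by have := H (Ordinal ltp); rewrite negbK /q /= nth_index // => /eqP.
  have ltW : W x < N.+1 by rewrite ltnS.
  rewrite (bigD1 (Ordinal ltW)) //= EE // eqxx muln1 big1 => [|w wW].
    case gW: (g (W x)); rewrite ?dvdn0 // !addn0 gtnNdvd //.
    exact: leq_trans (prime_gt1 p1pr) (dvdn_leq m0 p1m).
  rewrite EE -1?ltnS // (_ : (W x == w) = false) ?muln0 //; apply/negbTE.
  by rewrite eq_sym.
Qed.

Lemma expn_leq_prod (ps : seq nat) (f : nat -> nat) X :
  {in ps, forall p, X < f p} -> X.+1 ^ size ps <= \prod_(p <- ps) f p.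
Proof.
elim: ps => [|p ps IH] fP; first by rewrite big_nil.
rewrite big_cons expnS leq_mul ?fP ?mem_head // IH // => q qps.
by rewrite fP // inE qps orbT.
Qed.

Lemma trunc_log_prime_power p X : prime p -> 0 < X ->
  X < p ^ (trunc_log p X).+1 <= p * X.
Proof.
move=> ppr X0; rewrite trunc_log_ltn ?prime_gt1 // expnS leq_mul2l.
by rewrite trunc_logP ?prime_gt1 // orbT.
Qed.

Lemma two_primes m : 1 < size (primes m) ->
  exists p q, [/\ prime p, prime q, q < p, p %| m & q %| m].
Proof.
have psP p : p \in primes m -> prime p /\ p %| m.
  by rewrite mem_primes => /and3P[].
move: psP (sorted_primes m); case: (primes m) => [|q [|p ps]] // psP.
case/andP=> ltqp _ _.
have [qpr qm] := psP q (mem_head _ _).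
have [|ppr pm] := psP p; first by rewrite !inE eqxx orbT.
by exists p, q.
Qed.

(* A prime power just above [X] for each of the [r] primes of [m] gives moduli
   whose product exceeds [X ^ r >= N], at the price of degree only [m * X]. *)
Lemma computable_symmetric m F n D N X (ys : 'I_N -> n.-tuple bool -> bool)
    (g : nat -> bool) :
  0 < m -> 1 < size (primes m) -> 0 < X -> N <= X ^ size (primes m) ->
  m ^ (m * X).+1 <= F -> m * (m * X * N.+1 ^ (m * X)).+1 <= F ->
  m ^ (size (primes m)).+1 <= F -> N < F ->
  (forall i, computable m F D (ys i)) ->
  computable m F D.+4.+3 (fun x => g (\sum_i ys i x)).
Proof.
move=> m0 r1 X0 leN leF1 leF2 leF3 ltF ysP.
have [p1 [p2 [p1pr p2pr ltp p1m p2m]]] := two_primes r1.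
pose e p := (trunc_log p X).+1.
have psP p : p \in primes m -> prime p /\ p %| m.
  by rewrite mem_primes => /and3P[].
apply: (@computable_crt m p1 p2 (primes m) e _ _ _ N) => //.
- by apply/allP => p /psP[].
- exact: primes_uniq.
- apply: leq_ltn_trans leN _.
  apply: (@leq_trans (X.+1 ^ size (primes m))).
    by rewrite ltn_exp2r // ltnW.
  apply: expn_leq_prod => p /psP[ppr _].
  by case/andP: (trunc_log_prime_power ppr X0).
- move=> x; apply: (@leq_trans (\sum_(i < N) 1)).
    by apply: leq_sum => i _; case: (ys i x).
  by rewrite sum_nat_const card_ord muln1.
move=> p /psP[ppr pm] g'.
have lepe : p ^ e p <= m * X.
  case/andP: (trunc_log_prime_power ppr X0) => _ /leq_trans; apply.
  by rewrite leq_mul2r dvdn_leq ?orbT.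
apply: (computable_prime_power _ m0 p1pr p2pr) => //.
- by apply: leq_trans leF1; rewrite leq_pexp2l.
- apply: leq_trans leF2; rewrite leq_mul2l ltnS leq_mul ?orbT //.
  by rewrite leq_pexp2l.
Qed.

(** * Residues of the weight along a tree *)

Lemma sum_ltn_ord M k : k <= M -> \sum_(0 <= i < M) (i < k) = k.
Proof.
move=> lekM; rewrite (big_cat_nat (n := k)) //= addnC big_nat_cond big1 => [|i].
  rewrite add0n -[RHS]subn0 -[RHS]muln1 -sum_nat_const_nat.
  by apply: eq_big_nat => i /andP[_ ->].
by case/andP=> /andP[leki _] _; rewrite ltnNge leki.
Qed.

(* Residues mod [M] are passed up a [b]-ary tree in unary: a node adds the
   [b * M] bits [k < r_j] of the residues [r_j] of its [b] children. *)
Lemma computable_tree m F n b M :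
  0 < b -> 0 < M ->
  (forall D (zs : 'I_(b * M) -> n.-tuple bool -> bool),
     (forall i, computable m F D (zs i)) -> forall g : nat -> bool,
     computable m F D.+4.+3 (fun x => g (\sum_i zs i x))) ->
  forall t D (ys : nat -> n.-tuple bool -> bool),
    (forall i, computable m F D (ys i)) -> forall g : nat -> bool,
    computable m F (D + 7 * t.+1)
      (fun x => g ((\sum_(0 <= i < b ^ t) ys i x) %% M)).
Proof.
move=> b0 M0 symP; elim=> [|t IH] D ys ysP g.
  (* A leaf is a single bit, padded with zeros to the [b * M] inputs that [symP] expects. *)
  rewrite muln1 addnC; pose zs (i : 'I_(b * M)) x := (i == 0 :> nat) && ys 0 x.
  have zsP i : computable m F D (zs i).
    rewrite /zs; case: (_ == _) => //=.
    exact: (@computable_const _ _ _ _ _ false).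
  apply: eq_computable (symP _ _ zsP (fun w => g (w %% M))) => x.
  rewrite expn0 big_nat1 /zs; have bM0 : 0 < b * M by rewrite muln_gt0 b0.
  rewrite (bigD1 (Ordinal bM0)) //= big1 ?addn0 // => i.
  by rewrite -val_eqE /= => /negbTE->.
pose S j x := \sum_(0 <= i < b ^ t) ys (i + j * b ^ t) x.
(* Input [i] is the bit of threshold [i %% M] in the unary residue of child [i %/ M]. *)
pose zs (i : 'I_(b * M)) x := i %% M < S (i %/ M) x %% M.
have zsP i : computable m F (D + 7 * t.+1) (zs i).
  exact: (IH D _ (fun k => ysP (k + _)) (fun w => i %% M < w)).
rewrite [7 * _]mulnS addnCA.
apply: eq_computable (symP _ _ zsP (fun w => g (w %% M))) => x; congr (g _).
have -> : \sum_i zs i x = \sum_(0 <= j < b) S j x %% M.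
  rewrite -(big_mkord xpredT (fun i => i %% M < S (i %/ M) x %% M : nat)).
  rewrite big_nat_mul; apply: eq_bigr => j _.
  rewrite -{1}[j * M]add0n big_addn mulSn addnK.
  rewrite -[RHS](sum_ltn_ord (ltnW (ltn_pmod (S j x) M0))).
  apply: eq_big_nat => i /andP[_ ltiM].
  by rewrite addnC modnMDl modn_small // divnMDl // divn_small // addn0.
rewrite modn_summ expnS big_nat_mul; congr (_ %% M); apply: eq_bigr => j _.
by rewrite -{1}[j * b ^ t]add0n big_addn mulSn addnK.
Qed.

(** * Trading depth for size *)

Lemma sum_tnth_count n (x : n.-tuple bool) :
  \sum_(0 <= i < n) nth false x i = count_mem true x.
Proof.
rewrite -sum1_count [RHS]big_mkcond (big_nth false) size_tuple.
by apply: eq_bigr => i _; case: (nth false x i).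
Qed.

Lemma symmetric_funE n (f : n.-tuple bool -> bool) : symmetric_fun f ->
  exists g : nat -> bool, forall x, f x = g (\sum_(0 <= i < n) nth false x i).
Proof.
(* The canonical input of weight [w] has its ones in front. *)
move=> fS; exists (fun w => f [tuple i < w | i < n]) => x.
rewrite sum_tnth_count; apply: fS; rewrite -[RHS]sum_tnth_count.
rewrite -[LHS](@sum_ltn_ord n); last by rewrite -{2}(size_tuple x) count_size.
apply: eq_big_nat => i /andP[_ ltin]; congr nat_of_bool.
by rewrite -[i]/(val (Ordinal ltin)) -tnth_nth tnth_mktuple.
Qed.

(** Supplies the bases of the [t] coprime moduli. They depend on [t] alone, so their sum may enter
    the constant [K]. *)
Lemma exists_primes t : exists ps, [/\ all prime ps, uniq ps & size ps = t].
Proof.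
elim: t => [|t [ps [pspr ups <-]]]; first by exists [::].
have [p ltp ppr] := prime_above (\sum_(q <- ps) q).
exists (p :: ps); rewrite /= ppr pspr ups andbT; split=> //.
apply/negP => pps; move: ltp; rewrite (big_rem p) //=; lia.
Qed.

Lemma expn_leq_exp2 a k : a ^ k <= 2 ^ (a * k).
Proof.
by rewrite expnM; case: k => // k; rewrite leq_exp2r // ltnW // ltn_expl.
Qed.

(** With [r] primes in [m], [s] plays the role of [n ^ (1 / (r * t))] rounded up, and the tree has
    arity [b = s ^ r]. A node has at most [P * s ^ (2 * r) <= X ^ r] inputs, where [X = P * s ^ 2]
    and [P] is the sum of the auxiliary primes. Binomials of degree [O(X)], with the logarithm of
    the number of inputs bounded by [O(s)], give the exponent [s ^ 3]. *)
Lemma symmetric_circuit m t : 0 < m -> 1 < size (primes m) -> 0 < t ->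
  exists K, forall s n (f : n.-tuple bool -> bool),
    0 < s -> n <= s ^ (size (primes m) * t) -> symmetric_fun f ->
    exists C : circuit n, [/\ circuit_eval m C =1 f,
      circuit_depth C <= 7 * t + 11 & circuit_size C <= 2 ^ (K * s ^ 3)].
Proof.
move=> m0 r1 t0; set r := size (primes m) in r1 *.
have m1 : 1 < m by move: r1; rewrite /r; case: (m) m0 => [|[]].
have [ps [pspr ups szps]] := exists_primes t.
pose P := \sum_(p <- ps) p.
have leP p : p \in ps -> p <= P.
  by move=> pps; rewrite /P (big_rem p) //= leq_addr.
(* [A * s] bounds the binary logarithm of the number of inputs of a node; [k1] to [k3] serve the
   fan-in conditions of [computable_symmetric], [k4] and [k5] those of [computable_crt]. *)
pose A := P + 1 + 2 * r.
pose k1 := m * (m * P + 1); pose k2 := m + m * P + A * (m * P) + 1.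
pose k3 := m * r.+1; pose k4 := m * t.+1; pose k5 := r * t + 1.
pose K := A + k1 + k2 + k3 + k4 + k5.
have [[leA le1] [le2 le3] [le4 le5]] :
    [/\ A <= K /\ k1 <= K, k2 <= K /\ k3 <= K & k4 <= K /\ k5 <= K].
  by rewrite /K {K}; clearbody A k1 k2 k3 k4 k5; split; lia.
(* The tree has [t.+1] levels of depth 7, and Chinese remaindering adds 3. *)
pose D := 7 * t + 10.
(* Chosen to absorb [F.+1 ^ D + 1] for [F = 2 ^ (K * s ^ 3)]. *)
exists (D * (K + 1) + 1) => s n f s0 len fS.
set S := s ^ 3.
have S0 : 0 < S by rewrite expn_gt0 s0.
have leS1 : s <= S by rewrite -{1}[s]expn1 leq_pexp2l.
have leS2 : s ^ 2 <= S by rewrite leq_pexp2l.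
pose F := 2 ^ (K * S).
have leF k : k <= K -> 2 ^ (k * S) <= F.
  by move=> lek; rewrite leq_exp2l // leq_mul2r lek orbT.
have leFe e k : e <= k * S -> k <= K -> 2 ^ e <= F.
  by move=> leeS lek; apply: leq_trans (leF _ lek); rewrite leq_exp2l.
pose b := s ^ r; have b0 : 0 < b by rewrite expn_gt0 s0.
have [p1 [p2 [p1pr p2pr ltp p1m p2m]]] := two_primes r1.
have [g gE] := symmetric_funE fS.
pose ys i (x : n.-tuple bool) := nth false x i.
have ysP i : computable m F 0 (ys i).
  case: (ltnP i n) => [ltin|leni].
    apply: (@computable_input _ _ _ _ _ (Ordinal ltin)) => x.
    by rewrite (tnth_nth false).
  apply: (@computable_const _ _ _ _ _ false) => x.
  by rewrite /ys nth_default // size_tuple.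
have lenb : n <= b ^ t by rewrite -expnM.
have sumE x : \sum_(0 <= i < b ^ t) ys i x = \sum_(0 <= i < n) ys i x.
  rewrite (big_cat_nat (n := n)) //= [X in _ + X]big_nat_cond.
  rewrite [X in _ + X]big1 ?addn0 //.
  by move=> i /andP[/andP[leni _] _]; rewrite /ys nth_default // size_tuple.
(* [p ^ e p] is the first power of [p] above [b], so the product of the [t] moduli exceeds
   [b ^ t >= n]. *)
pose e p := (trunc_log p b).+1.
pose X := P * s ^ 2.
have symP p : p \in ps ->
     forall D (zs : 'I_(b * p ^ e p) -> n.-tuple bool -> bool),
     (forall i, computable m F D (zs i)) -> forall g : nat -> bool,
     computable m F D.+4.+3 (fun x => g (\sum_i zs i x)).
  move=> pps D' zs zsP g'.
  have ppr := allP pspr _ pps.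
  have P0 : 0 < P := leq_trans (prime_gt0 ppr) (leP _ pps).
  have leN : b * p ^ e p <= P * s ^ (2 * r).
    have /andP[_ lepb] := trunc_log_prime_power ppr b0.
    apply: (@leq_trans (b * (p * b))); first by rewrite leq_mul2l lepb orbT.
    rewrite mulnCA -expnD addnn -mul2n leq_mul2r leP ?orbT //.
  have leNA : (b * p ^ e p).+1 <= 2 ^ (A * s).
    apply: (@leq_trans (P.+1 * s ^ (2 * r))).
      by rewrite mulSn addnC -addn1 leq_add // expn_gt0 s0.
    apply: (@leq_trans (2 ^ P.+1 * 2 ^ (s * (2 * r)))).
      by rewrite leq_mul ?expn_leq_exp2 // ltnW // ltn_expl.
    by rewrite -expnD leq_exp2l // /A addn1 mulnDl
      [s * _]mulnC leq_add2r leq_pmulr.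
  apply: (@computable_symmetric _ _ _ _ _ X) => //.
  - by rewrite muln_gt0 P0 expn_gt0 s0.
  - apply: leq_trans leN _; rewrite expnMn -expnM leq_mul2r -{1}[P]expn1.
    by rewrite leq_pexp2l ?orbT // ltnW.
  - apply: leq_trans (expn_leq_exp2 _ _) _.
    apply: (leFe _ k1) => //; rewrite /k1.
    rewrite -mulnA leq_mul2l /X -addn1 mulnDl mul1n leq_add ?orbT //.
    by rewrite mulnA leq_mul2l leS2 orbT.
  - have leX : m * X <= m * P * S by rewrite /X mulnA leq_mul2l leS2 orbT.
    have leE : (b * p ^ e p).+1 ^ (m * X) <= 2 ^ (A * (m * P) * S).
      apply: (@leq_trans ((2 ^ (A * s)) ^ (m * X))).
        by case: (m * X) => // k; rewrite leq_exp2r.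
      rewrite -expnM leq_exp2l // /X mulnA.
      rewrite [A * _ * _]mulnAC mulnCA -mulnA -expnS -/S.
      by rewrite mulnA leq_mul2r [P * _]mulnC -mulnA leqnn orbT.
    apply: (@leq_trans (2 ^ m * 2 ^ (m * P * S + A * (m * P) * S + 1))).
      apply: leq_mul; first exact: ltnW (ltn_expl _ _).
      rewrite expnD expn1 muln2 -addnn -addn1 leq_add ?expn_gt0 // expnD.
      apply: leq_mul leE; apply: leq_trans leX _; exact: ltnW (ltn_expl _ _).
    rewrite -expnD.
    apply: (leFe _ k2) => //; rewrite /k2.
    rewrite !mulnDl mul1n -!addnA; apply: leq_add; first exact: leq_pmulr.
    by rewrite !leq_add2l.
  - apply: leq_trans (expn_leq_exp2 _ _) _.
    by apply: (leFe _ k3) => //; rewrite leq_pmulr.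
  - apply: leq_trans leNA _.
    by apply: (leFe _ A) => //; rewrite leq_mul2l leS1 orbT.
have cP : computable m F D (fun x => ~~ g (\sum_(0 <= i < n) ys i x)).
  apply: (@eq_computable _ _ _ _ (fun x => ~~ g (\sum_(0 <= i < b ^ t) ys i x))).
    by move=> x; rewrite sumE.
  rewrite (_ : D = (0 + 7 * t.+1).+3); last by rewrite /D; clear; lia.
  apply: (@computable_crt _ p1 p2 ps e _ _ _ n _ (fun w => ~~ g w)) => //.
  - apply: leq_ltn_trans lenb _; apply: (@leq_trans (b.+1 ^ t)).
      by rewrite ltn_exp2r.
    rewrite -szps; apply: expn_leq_prod => p pps.
    by case/andP: (trunc_log_prime_power (allP pspr _ pps) b0).
  - rewrite szps; apply: leq_trans (expn_leq_exp2 _ _) _.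
    by apply: (leFe _ k4) => //; rewrite leq_pmulr.
  - apply: (@leq_trans (2 ^ (s * (r * t) + 1))).
      rewrite expnD expn1 muln2 -addnn -addn1 leq_add ?expn_gt0 //.
      exact: leq_trans len (expn_leq_exp2 _ _).
    apply: (leFe _ k5) => //; rewrite /k5.
    by rewrite mulnDl mul1n leq_add // mulnC leq_mul2l leS1 orbT.
  - move=> x; rewrite sumE; apply: (@leq_trans (\sum_(0 <= i < n) 1)).
      by apply: leq_sum => i _; case: (ys i x).
    by rewrite sum_nat_const_nat subn0 muln1.
  move=> p pps g'.
  apply: (computable_tree _ _ (symP p pps)) => //.
  by rewrite expn_gt0 prime_gt0 // (allP pspr).
have cP' : computable m F D (fun x => ~~ f x).
  by apply: eq_computable cP => x; rewrite gE.
have [C [CE Cd Cs]] := computable_circuit m1 cP'.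
exists C; split=> //; first by rewrite -addn1 /D -addnA in Cd.
apply: leq_trans Cs _.
apply: (@leq_trans (2 ^ ((K * S + 1) * D + 1))).
  rewrite [in leqRHS]expnD expn1 muln2 -addnn -addn1 leq_add ?expn_gt0 // expnM.
  rewrite leq_exp2r ?/D ?addn_gt0 ?orbT // expnD expn1 muln2 -addnn -addn1.
  by rewrite leq_add ?expn_gt0.
rewrite leq_exp2l // [leqRHS]mulnDl mul1n leq_add // mulnC -mulnA leq_mul2l mulnDl.
by rewrite mul1n leq_add2l S0 orbT.
Qed.

(* Asymptotic form of the bound *)
From mathcomp Require Import all_classical all_reals all_analysis.
Import Order.TTheory GRing.Theory Num.Theory.
Import numFieldNormedType.Exports.
Local Open Scope classical_set_scope.
Local Open Scope ring_scope.

Theorem theorem1p3 (R : realType) :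
  exists c : R, 1 <= c /\
  exists d0 : nat, forall d : nat, (d0 <= d)%N ->
  forall m r : nat, composite m -> size (primes m) = r -> (1 < r)%N ->
  exists g : nat -> R,
    g =O_\oo (fun n : nat => n%:R `^ (c / ((d%:R - c) * (r%:R - 1)))) /\
    forall (n : nat) (f : n.-tuple bool -> bool), symmetric_fun f ->
    exists C : circuit n,
      [/\ circuit_eval m C =1 f, (circuit_depth C <= d)%N
        & (circuit_size C)%:R <= expR (g n)].
Proof.
(* With [t = d %/ 18 >= 1], the depth is [7 * t + 11 <= 18 * t <= d], and
   [d <= 18 * (t + 1) <= 36 * t] yields [3 / (r * t) <= 108 / ((d - 108) * (r - 1))]. Thus 108 is
   [3 * 36], and 109 makes [d - 108] positive. *)
exists 108; split; first by rewrite ler1n.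
exists 109%N => d led m r mcomp szm r1.
have m0 : (0 < m)%N by case/andP: mcomp => /ltnW.
pose t := (d %/ 18)%N.
have t0 : (0 < t)%N by rewrite divn_gt0 // (leq_trans _ led).
have led18 : (18 * t <= d)%N by rewrite mulnC leq_trunc_div.
have ltd18 : (d < 18 * t.+1)%N by rewrite mulnC ltn_ceil.
have := @symmetric_circuit m t m0; rewrite szm => /(_ r1 t0)[K KP].
have rt0 : 0 < (r * t)%:R :> R by rewrite ltr0n muln_gt0 t0 ltnW.
pose a : R := (r * t)%:R^-1.
(* The successor keeps [s n] positive and ensures [n <= s n ^ (r * t)] for every [n], including
   0. *)
pose s n := (Num.truncn (n%:R `^ a : R)).+1.
have lts n : n%:R `^ a < (s n)%:R :> R by apply: truncnS_gt.
exists (fun n => (K * s n ^ 3)%:R); split.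
  set ex := _ / _; have lea : a * 3 <= ex.
    have tR : 3 * (d%:R - 108) <= 108 * t%:R :> R.
      have : d%:R <= (18 * t.+1)%:R :> R by rewrite ler_nat ltnW.
      have : 1 <= t%:R :> R by rewrite ler1n.
      rewrite natrM -natr1; lra.
    have d0 : 0 < d%:R - 108 :> R by rewrite subr_gt0 ltr_nat.
    have r0 : 0 < r%:R - 1 :> R by rewrite subr_gt0 ltr1n.
    rewrite /ex ler_pdivlMr ?mulr_gt0 // -mulrA ler_pdivrMl // mulrA natrM.
    rewrite [leRHS](_ : _ = 108 * t%:R * r%:R); last by ring.
    apply: ler_pM => //; rewrite ?mulr_ge0 ?(ltW d0) ?(ltW r0) //.
    by rewrite lerBlDr lerDl.
  (* The 8 is the cube of 2, from [s n <= 2 * n ^ a] for [n >= 1]; [K.+1] keeps the constant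
     positive. *)
  apply/eqO_exP; exists (K.+1%:R * 8); first by rewrite mulr_gt0.
  near=> n.
  have n1 : 1 <= n%:R :> R by rewrite ler1n; near: n; exact: nbhs_infty_ge.
  have na1 : 1 <= n%:R `^ a.
    by rewrite -[leLHS](powRr0 n%:R) ler_powR // invr_ge0 ltW.
  rewrite !ger0_norm ?powR_ge0 ?ler0n // natrM -mulrA ler_pM ?ler_nat // natrX.
  apply: (@le_trans _ _ ((2 * n%:R `^ a) ^+ 3)).
    rewrite lerXn2r ?nnegrE ?mulr_ge0 ?powR_ge0 ?ler0n // mulr_natl mulr2n.
    by rewrite /s -natr1 lerD // truncn_le // powR_ge0.
  rewrite exprMn -natrX ler_pM2l // -powR_mulrn ?powR_ge0 // -powRrM.
  by rewrite ler_powR.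
move=> n f fS; have [||C [CE Cd Cs]] := KP (s n) n f _ _ fS => //.
  rewrite -(ler_nat R) natrX.
  have {1}-> : n%:R = (n%:R `^ a) ^+ (r * t) :> R.
    by rewrite -powR_mulrn ?powR_ge0 // -powRrM mulVf ?gt_eqF // powRr1.
  by rewrite lerXn2r ?nnegrE ?powR_ge0 ?ler0n // ltW.
exists C; split=> //; first by apply: leq_trans Cd _; lia.
apply: (@le_trans _ _ (2 ^ (K * s n ^ 3))%:R); first by rewrite ler_nat.
(* Base 2 is replaced by base [e], as [2 = 1 + 1 <= expR 1]. *)
rewrite natrX -[(K * _)%:R]mulr1 expRM_natl lerXn2r ?nnegrE ?expR_ge0 //.
exact: expR_ge1Dx.
Unshelve. all: by end_near.
Qed.
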